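(* Let $N\ge1$, $S\subset\mathbb{R}^N$, and let $\sigma,\sigma'$ be Borel measures on $S$. Assume that $(S,\sigma)$ and $(S,\sigma')$ are symmetric with respect to the origin, that is, $S=-S$ and $\sigma(A)=\sigma(-A)$, $\sigma'(A)=\sigma'(-A)$ for all Borel subsets $A$ of $S$. Then for any $q\ge2$ we have $$\mathcal{M}(S,\sigma,\sigma',q)=\mathcal{M}_{\mathrm{sym}}(S,\sigma,\sigma',q).$$ Moreover, there is an optimizer for $\mathcal{M}(S,\sigma,\sigma',q)$ if and only if there is one for $\mathcal{M}_{\mathrm{sym}}(S,\sigma,\sigma',q)$.
   Context: For $f\in L^1(S,\sigma)$ (complex-valued) define $\check f(x):=\int_Se^{ix\cdot\omega}f(\omega)\,d\sigma(\omega)$ for $x\in\mathbb{R}^N$. Define $$\mathcal{M}(S,\sigma,\sigma',q):=\sup\left\{\frac{\|\check f\|_{L^q(\mathbb{R}^N)}}{\|f\|_{L^2(S,\sigma')}}:\ f\in L^1(S,\sigma)\cap L^2(S,\sigma')\setminus\{0\}\right\}$$ and, when $S=-S$, $$\mathcal{M}_{\mathrm{sym}}(S,\sigma,\sigma',q):=\sup\left\{\frac{\|\check f\|_{L^q(\mathbb{R}^N)}}{\|f\|_{L^2(S,\sigma')}}:\ f\in L^1(S,\sigma)\cap L^2(S,\sigma')\setminus\{0\},\ f(\omega)=\overline{f(-\omega)}\text{ a.e. on }S\right\}.$$ The condition $f\in L^1(S,\sigma)$ is imposed only so that $\check f$ is a priori well-defined. Once $\mathcal{M}(S,\sigma,\sigma',q)<\infty$,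 $\check f\in L^q(\mathbb{R}^N)$ is defined for every $f\in L^2(S,\sigma')$ and the condition $f\in L^1(S,\sigma)$ can be dropped; in particular, an optimizer for $\mathcal{M}$ or $\mathcal{M}_{\mathrm{sym}}$ (a nonzero $f\in L^2(S,\sigma')$, satisfying the symmetry condition in the case of $\mathcal{M}_{\mathrm{sym}}$, at which the supremum is attained) is not required to satisfy $f\in L^1(S,\sigma)$. *)

(* Defs.v *)
From HB Require Import structures.
From mathcomp Require Import all_boot all_order all_algebra.
From mathcomp Require Import complex.
From mathcomp Require Import all_classical all_reals all_analysis.
From mathcomp Require Import measurable_realfun.

Set Implicit Arguments.
Unset Strict Implicit.
Unset Printing Implicit Defensive.

Import Order.TTheory GRing.Theory Num.Theory.
Import numFieldNormedType.Exports.

Local Open Scope classical_set_scope.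
Local Open Scope ring_scope.

Definition borelRV (R : realType) (n : nat) :=
  g_sigma_algebraType (@open 'rV[R]_n).

(* Lebesgue measure on the Borel sets of R^n, as the n-fold product of the
   one-dimensional Lebesgue measure transported along R * R^n ~ R^(n+1); it is
   characterized by lebesgue_rV_box below. *)
Section lebesgue_rV.
Variable R : realType.

Definition consRV n (p : measurableTypeR R * borelRV R n) : borelRV R n.+1 :=
  row_mx (p.1%:M : 'rV_1) (p.2 : 'rV[R]_n).

Definition headRV n (v : borelRV R n.+1) : measurableTypeR R :=
  (v : 'rV[R]_n.+1) 0 0.

Definition tailRV n (v : borelRV R n.+1) : borelRV R n :=
  rsubmx (v : 'rV[R]_(1 + n)).

Lemma consRV0 n p : (@consRV n p : 'rV[R]_n.+1) 0 0 = p.1.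
Proof.
rewrite /consRV; set M := row_mx _ _.
rewrite -[LHS]/((M : 'rV[R]_(1 + n)) 0 0).
have -> : (0 : 'I_(1 + n)) = lshift n 0 by apply/val_inj.
by rewrite row_mxEl mxE eqxx mulr1n.
Qed.

Lemma consRVS n p j : (@consRV n p : 'rV[R]_n.+1) 0 (rshift 1 j) =
  (p.2 : 'rV[R]_n) 0 j.
Proof. exact: (row_mxEr (p.1%:M : 'rV_1) (p.2 : 'rV[R]_n)). Qed.

Lemma headRVK n p : headRV (@consRV n p) = p.1.
Proof. exact: consRV0. Qed.

Lemma tailRVK n p : tailRV (@consRV n p) = p.2.
Proof. by rewrite /tailRV /consRV row_mxKr. Qed.

Lemma ball_rVE n (x y : 'rV[R]_n) (e : R) : 0 < e ->
  ball x e y <-> forall i, `|x 0 i - y 0 i| < e.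
Proof.
move=> e0; split=> [[_ h] i|h]; first exact: h.
by split=> // i j; rewrite ord1; exact: h.
Qed.

Lemma measurable_consRV n : measurable_fun setT (@consRV n).
Proof.
apply: (@measurability _ _ _ _ setT (@consRV n)
  (@open 'rV[R]_n.+1 : set (set (borelRV R n.+1)))) => // _ [U oU <-].
rewrite setTI.
pose box (q : rat * 'rV[rat]_n * rat) : set (measurableTypeR R * borelRV R n) :=
  ball (ratr q.1.1 : R) (ratr q.2 : R)
    `*` ball (map_mx ratr q.1.2 : 'rV[R]_n) (ratr q.2 : R).
pose I := [set q | box q `<=` @consRV n @^-1` U].
rewrite (_ : _ @^-1` U = \bigcup_(q in I) box q); last first.
  apply/seteqP; split=> [[x v]/= Ux|p [q Iq]]; last exact: Iq.
  have /nbhs_ballP[e /= e0 eU] : nbhs (consRV (x, v) : 'rV[R]_n.+1) U.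
    exact: open_nbhs_nbhs.
  have e20 : 0 < e / 2 by rewrite divr_gt0.
  have [d] := rat_in_itvoo e20; rewrite in_itv/= => /andP[d0 de].
  have ap (y : R) : {q : rat | `|ratr q - y| < ratr d}.
    apply: cid; have /rat_in_itvoo[q] : y - ratr d < y + ratr d.
      by rewrite ltrD2l (lt_trans _ d0)// oppr_lt0.
    by rewrite in_itv/= => qy; exists q; rewrite ltr_distl.
  pose w : 'rV[rat]_n := \row_i sval (ap ((v : 'rV[R]_n) 0 i)).
  exists (sval (ap x), w, d); last first.
    split=> /=; first by rewrite /ball/=; exact: (svalP (ap x)).
    apply/ball_rVE => // i; rewrite !mxE; exact: (svalP (ap _)).
  move=> [y u] [/= bxy /(ball_rVE _ _ d0) bvu]; apply: eU.
  apply/ball_rVE => // i.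
  have tri (a b c : R) : `|c - a| < ratr d -> `|c - b| < ratr d -> `|a - b| < e.
    move=> ca cb; have -> : a - b = (c - b) - (c - a).
      by rewrite opprB [RHS]addrC addrA addrNK.
    rewrite (le_lt_trans (ler_normB _ _))// [ltRHS](splitr e).
    by rewrite ltrD// (lt_trans _ de).
  case: (@splitP 1 n i) => j ij.
    have -> : i = 0 by apply/ord_inj; rewrite ij ord1.
    by rewrite !consRV0; apply: tri; [exact: (svalP (ap x))|exact: bxy].
  have -> : i = rshift 1 j by exact/ord_inj.
  rewrite !consRVS/=; apply: tri (bvu j).
  by rewrite !mxE; exact: (svalP (ap _)).
rewrite bigcup_mkcond; apply: countable_bigcupT_measurable.
  exact: countableP.
move=> q; case: ifPn => // _; apply: measurableX.
  by apply: open_measurable; exact: ball_open.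
by apply: sub_sigma_algebra; exact: ball_open.
Qed.


Lemma measurable_coordRV n i :
  measurable_fun setT (fun v : borelRV R n => (v : 'rV[R]_n) 0 i : R).
Proof.
apply: (measurability _ (RGenOpens.measurableE R)) => _ [_ [a [b ->]] <-].
rewrite setTI; apply: sub_sigma_algebra.
apply: open_comp; last exact: interval_open.
by move=> v _; exact: coord_continuous.
Qed.

Lemma measurable_tailRV n : measurable_fun setT (@tailRV n).
Proof.
apply: (@measurability _ _ _ _ setT (@tailRV n)
  (@open 'rV[R]_n : set (set (borelRV R n)))) => // _ [U oU <-].
rewrite setTI; apply: sub_sigma_algebra.
apply: (@open_comp 'rV[R]_n.+1 'rV[R]_n) => // v _ A /nbhs_ballP[e /= e0 eA].
apply/nbhs_ballP; exists e => //= w /(ball_rVE _ _ e0) vw; apply: eA.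
by apply/ball_rVE => // i; rewrite !mxE; exact: vw.
Qed.

Lemma measurable_rect n (A : set (measurableTypeR R)) (B : set (borelRV R n)) :
  measurable A -> measurable B ->
  measurable [set v : borelRV R n.+1 | A (headRV v) /\ B (tailRV v)].
Proof.
move=> mA mB; apply: measurableI.
  rewrite -[X in measurable X]setTI.
  by apply: (@measurable_coordRV n.+1 0) => //; exact: mA.
by rewrite -[X in measurable X]setTI; exact: measurable_tailRV.
Qed.

Section lebesgue_step.
Variables (n : nat) (m : {sigma_finite_measure set (borelRV R n) -> \bar R}).
Local Open Scope ereal_scope.

Definition lebesgue_step : set (borelRV R n.+1) -> \bar R :=
  pushforward (@lebesgue_measure R \x m) (@consRV n).

Let step0 : lebesgue_step set0 = 0.
Proof. by rewrite /lebesgue_step /pushforward preimage_set0 measure0. Qed.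

Let step_ge0 A : 0 <= lebesgue_step A.
Proof. by rewrite /lebesgue_step /pushforward measure_ge0. Qed.

Let step_sigma_additive : semi_sigma_additive lebesgue_step.
Proof.
apply: (@measure_semi_sigma_additive _ _ _
  (pushforward (@lebesgue_measure R \x m) (@consRV n))).
exact: measurable_consRV.
Qed.

HB.instance Definition _ := isMeasure.Build _ _ _ lebesgue_step
  step0 step_ge0 step_sigma_additive.

Lemma lebesgue_step_rect (A : set (measurableTypeR R)) (B : set (borelRV R n)) :
  measurable A -> measurable B ->
  lebesgue_step [set v | A (headRV v) /\ B (tailRV v)] =
    lebesgue_measure A * m B.
Proof.
move=> mA mB; rewrite -product_measure1E// /lebesgue_step /pushforward.
by congr (_ _); apply/seteqP; split=> -[x v] /=; rewrite headRVK tailRVK.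
Qed.

Let step_sigma_finite : sigma_finite setT lebesgue_step.
Proof.
have /sigma_finiteP[F [TF ndF Foo]] := sigma_finiteT (@lebesgue_measure R).
have /sigma_finiteP[G [TG ndG Goo]] := sigma_finiteT m.
exists (fun k => [set v | F k (headRV v) /\ G k (tailRV v)]).
  apply/seteqP; split=> // v _.
  have [i _ Fi] : (\bigcup_i F i) (headRV v) by rewrite -TF.
  have [j _ Gj] : (\bigcup_i G i) (tailRV v) by rewrite -TG.
  exists (maxn i j) => //; split.
  - by move: Fi; exact/subsetPset/ndF/leq_maxl.
  - by move: Gj; exact/subsetPset/ndG/leq_maxr.
move=> k; have [mF Fk] := Foo k; have [mG Gk] := Goo k.
split; first exact: measurable_rect.
by rewrite lebesgue_step_rect// lte_mul_pinfty// ge0_fin_numE.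
Qed.

HB.instance Definition _ := Measure_isSigmaFinite.Build _ _ _ lebesgue_step
  step_sigma_finite.

End lebesgue_step.

Fixpoint lebesgue_rV (n : nat) :
    {sigma_finite_measure set (borelRV R n) -> \bar R} :=
  match n with
  | 0 => \d_(0 : borelRV R 0)
  | n'.+1 => lebesgue_step (lebesgue_rV n')
  end.

Lemma measurable_box n (A : 'I_n -> set (measurableTypeR R)) :
  (forall i, measurable (A i)) ->
  measurable [set v : borelRV R n | forall i, A i ((v : 'rV[R]_n) 0 i)].
Proof.
move=> mA; rewrite (_ : [set _ | _] =
  \bigcap_i [set v : borelRV R n | A i ((v : 'rV[R]_n) 0 i)]); last first.
  by apply/seteqP; split=> v /= h i; [move=> _|]; exact: h.
apply: fin_bigcap_measurable => // i _.
rewrite -[X in measurable X]setTI.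
by apply: (@measurable_coordRV n i) => //; exact: mA.
Qed.

Lemma lebesgue_rV_box n (A : 'I_n -> set (measurableTypeR R)) :
  (forall i, measurable (A i)) ->
  lebesgue_rV n [set v | forall i, A i ((v : 'rV[R]_n) 0 i)] =
    (\prod_i lebesgue_measure (A i))%E.
Proof.
elim: n A => [|n IH] A mA /=.
  by rewrite big_ord0 diracE mem_set// => -[].
rewrite big_ord_recl -IH// -lebesgue_step_rect//; last first.
  by apply: (@measurable_box n (fun i => A (lift ord0 i))) => i; exact: mA.
congr (_ _); apply/seteqP; split=> v /=.
  move=> h; split=> [|i]; first exact: h.
  rewrite /tailRV mxE (_ : rshift 1 i = lift ord0 i); first exact: h.
  exact/ord_inj.
move=> [h0 hS] i; case: (unliftP 0 i) => [j ->|-> //].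
have := hS j; rewrite /tailRV mxE (_ : rshift 1 j = lift ord0 j)//.
exact/ord_inj.
Qed.

End lebesgue_rV.

(* The measurable space of the Borel subsets of an arbitrary S `<=` R^n. Since
   a measurableType is inhabited whereas S may be empty, and S need not be a
   Borel set, the carrier is R^n and a set is measurable when its trace on S is
   the trace of a Borel set. A Borel measure on S is thus the same thing as a
   measure on onset S for which ~` S is null, and functions on S are functions
   on onset S whose values off S are irrelevant. *)
Definition onset (R : realType) n (S : set 'rV[R]_n) : Type := 'rV[R]_n.

Definition onset_display (R : realType) n (S : set 'rV[R]_n) : measure_display.
Proof. by constructor. Qed.

Section onset.
Variables (R : realType) (n : nat) (S : set 'rV[R]_n).

HB.instance Definition _ := Pointed.on (onset S).

Definition trace_borel : set (set (onset S)) :=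
  [set A | exists2 B : set (borelRV R n), measurable B & A `&` S = B `&` S].

Let trace_borel0 : trace_borel set0.
Proof. by exists set0. Qed.

Let trace_borelC A : trace_borel A -> trace_borel (~` A).
Proof.
move=> [B mB AB]; exists (~` B); first exact: measurableC.
apply/seteqP; split=> x [nAx Sx]; split=> // hx; apply: nAx.
  by have [] : (A `&` S) x by rewrite AB.
by have [] : (B `&` S) x by rewrite -AB.
Qed.

Let trace_borel_bigcup (F : (set (onset S))^nat) :
  (forall i, trace_borel (F i)) -> trace_borel (\bigcup_i F i).
Proof.
move=> mF; pose G i := sval (cid2 (mF i)).
exists (\bigcup_i G i).
  by apply: bigcupT_measurable => i; rewrite /G; case: cid2.
by rewrite !setI_bigcupl; apply: eq_bigcupr => i _; rewrite /G; case: cid2.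
Qed.

HB.instance Definition _ := @isMeasurable.Build (onset_display S)
  (onset S) trace_borel trace_borel0 trace_borelC trace_borel_bigcup.

End onset.

Section complex_Lp.
Local Open Scope ereal_scope.
Context d (T : measurableType d) (R : realType).
Variable mu : {measure set T -> \bar R}.
Implicit Types f : T -> R[i].

Definition cintegral (D : set T) f : R[i] :=
  Complex (\int[mu]_(w in D) complex.Re (f w))%R
          (\int[mu]_(w in D) complex.Im (f w))%R.

Definition cLnorm (p : \bar R) f : \bar R :=
  Lnorm mu p (fun w => (Normc.normc (f w))%:E).

Definition cLp (p : \bar R) f : Prop :=
  [/\ measurable_fun setT (fun w => complex.Re (f w)),
      measurable_fun setT (fun w => complex.Im (f w)) &
      cLnorm p f < +oo].

End complex_Lp.

Section fourier_extension.
Context (R : realType) (N : nat) (S : set 'rV[R]_N).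
Variables (sigma sigma' : {measure set (onset S) -> \bar R}) (q : \bar R).
Local Open Scope ereal_scope.
Implicit Types (f : onset S -> R[i]) (F : borelRV R N -> R[i]).

Let leb := lebesgue_rV R N.

Definition dotV (x w : 'rV[R]_N) : R := (\sum_i x 0 i * w 0 i)%R.

Definition expi (t : R) : R[i] := Complex (cos t) (sin t).

Definition fcheck f : borelRV R N -> R[i] :=
  fun x => cintegral sigma S (fun w => (expi (dotV x w) * f w)%R).

Definition L1L2 f : Prop := cLp sigma 1 f /\ cLp sigma' 2%:E f.

Definition nonzero f : Prop := ~ {ae sigma', forall w, f w = 0%R}.

(* In L^1(sigma) `&` L^2(sigma') functions are identified when they agree a.e.
   for both measures, hence "a.e. on S" refers to both. *)
Definition conj_sym f : Prop :=
  let P := fun w : onset S => f w = conjc (f (- (w : 'rV[R]_N))%R) in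
  {ae sigma, forall w, P w} /\ {ae sigma', forall w, P w}.

Definition calM : \bar R :=
  ereal_sup [set cLnorm leb q (fcheck f) / cLnorm sigma' 2%:E f |
             f in [set f | L1L2 f /\ nonzero f]].

Definition calM_sym : \bar R :=
  ereal_sup [set cLnorm leb q (fcheck f) / cLnorm sigma' 2%:E f |
             f in [set f | [/\ L1L2 f, nonzero f & conj_sym f]]].

(* F is the transform of f: either by the integral formula or, once calM is
   finite, as the L^q limit along an approximation of f in L^2(sigma'). *)
Definition is_check f F : Prop :=
  (cLp sigma 1 f /\ F = fcheck f) \/
  [/\ calM < +oo, cLp leb q F &
      exists f_ : nat -> onset S -> R[i],
        [/\ forall k, L1L2 (f_ k),
            cLnorm sigma' 2%:E (fun w => (f_ k w - f w)%R)
              @[k --> \oo] --> 0 &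
            cLnorm leb q (fun x => (fcheck (f_ k) x - F x)%R)
              @[k --> \oo] --> 0]].

Definition attains (M : \bar R) f : Prop :=
  exists2 F, is_check f F & cLnorm leb q F / cLnorm sigma' 2%:E f = M.

Definition optimizer f : Prop :=
  [/\ cLp sigma' 2%:E f, nonzero f & attains calM f].

Definition optimizer_sym f : Prop :=
  [/\ cLp sigma' 2%:E f, nonzero f, conj_sym f & attains calM_sym f].

End fourier_extension.

(* Main.v *)
Require Import Defs.
From HB Require Import structures.
From mathcomp Require Import all_boot all_order all_algebra.
From mathcomp Require Import complex.
From mathcomp Require Import all_classical all_reals all_analysis.
From mathcomp Require Import measurable_realfun ring lra.

(* Every f splits as f = g + i h with g, h invariant under the reflection
   f |-> conj (f (- w)). The transforms of g and h are the real and imaginary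
   parts F = G + i H of the transform of f, while the symmetry of sigma' gives
   ||f||^2 = ||g||^2 + ||h||^2 in L^2(sigma'). As q >= 2, the triangle
   inequality in L^(q/2) gives ||F||_q^2 <= ||G||_q^2 + ||H||_q^2, so a bound
   on symmetric functions holds for all functions with the same constant, and
   equality for f forces equality for both g and h. *)

Set Implicit Arguments.
Unset Strict Implicit.
Unset Printing Implicit Defensive.

Import Order.TTheory GRing.Theory Num.Theory.
Import numFieldNormedType.Exports.

Local Open Scope classical_set_scope.
Local Open Scope ring_scope.

(** The norm in the denominator sees only [sigma'], the transform only [sigma], and nothing relates
    the two measures. A symmetric part g or h of f may therefore vanish [sigma']-a.e. and still have
    a nonzero transform; it is then no competitor for the symmetric supremum, whose bound says
    nothing about it directly. If the supremum is finite, perturbing a competitor by large multiples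
    of such a part shows that its transform has zero norm. If the supremum is infinite, such a part
    may be what carries the infinite norm, and adding it to the other part yields a symmetric
    optimizer. A second obstacle is that an optimizer may lie outside L^1([sigma]), its transform
    being only an L^q limit; the splitting and the bound have to be carried over to the
    approximating sequence. The equality case also needs all norms to be finite, which is why finite
    and infinite suprema are treated apart. *)

Lemma normc_ReIm (R : rcfType) (z : R[i]) :
  Normc.normc z = Num.sqrt (complex.Re z ^+ 2 + complex.Im z ^+ 2).
Proof. by case: z. Qed.

Lemma sqr_normc_ReIm (R : rcfType) (z : R[i]) :
  Normc.normc z ^+ 2 = complex.Re z ^+ 2 + complex.Im z ^+ 2.
Proof. by rewrite normc_ReIm sqr_sqrtr// addr_ge0// sqr_ge0. Qed.

Lemma normc_ge0 (R : rcfType) (z : R[i]) : 0 <= Normc.normc z.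
Proof. by rewrite normc_ReIm sqrtr_ge0. Qed.

Lemma normc_conjc (R : rcfType) (z : R[i]) :
  Normc.normc (conjc z) = Normc.normc z.
Proof. by rewrite !normc_ReIm; case: z => a b /=; rewrite sqrrN. Qed.

Lemma normc_complexr (R : rcfType) (a : R) : Normc.normc (Complex a 0) = `|a|.
Proof. by rewrite normc_ReIm/= expr0n/= addr0 sqrtr_sqr. Qed.

Lemma ler_Re_normc (R : rcfType) (z : R[i]) :
  `|complex.Re z| <= Normc.normc z.
Proof. by rewrite normc_ReIm -sqrtr_sqr ler_wsqrtr// lerDl sqr_ge0. Qed.

Lemma ler_Im_normc (R : rcfType) (z : R[i]) :
  `|complex.Im z| <= Normc.normc z.
Proof. by rewrite normc_ReIm -sqrtr_sqr ler_wsqrtr// lerDr sqr_ge0. Qed.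

Lemma poweRe2 (R : realType) (x : \bar R) : (0 <= x)%E -> (x `^ 2 = x ^+ 2)%E.
Proof.
case: x => [r| |]//; rewrite ?lee_fin => r0.
  by rewrite poweR_EFin -EFin_expe powR_mulrn.
by rewrite poweRyr// expeS mulyy.
Qed.

(** * L^p norms of complex-valued functions *)

Section complex_valued.
Context d (T : measurableType d) (R : realType).
Variable mu : {measure set T -> \bar R}.
Implicit Types (f g : T -> R[i]) (c : R[i]) (p : R).

Definition cmeasurable f :=
  measurable_fun setT (fun w => complex.Re (f w)) /\
  measurable_fun setT (fun w => complex.Im (f w)).

Lemma cLp_cmeasurable (q : \bar R) f : cLp mu q f -> cmeasurable f.
Proof. by case. Qed.

Lemma cmeasurableD f g : cmeasurable f -> cmeasurable g ->
  cmeasurable (fun w => f w + g w).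
Proof.
move=> [rf jf] [rg jg]; split.
- rewrite (_ : (fun _ => _) = (fun w => complex.Re (f w) + complex.Re (g w))).
    exact: measurable_funD.
  by apply/funext => w; case: (f w); case: (g w).
- rewrite (_ : (fun _ => _) = (fun w => complex.Im (f w) + complex.Im (g w))).
    exact: measurable_funD.
  by apply/funext => w; case: (f w); case: (g w).
Qed.

Lemma cmeasurableM f g : cmeasurable f -> cmeasurable g ->
  cmeasurable (fun w => f w * g w).
Proof.
move=> [rf jf] [rg jg]; split.
- rewrite (_ : (fun _ => _) = (fun w => complex.Re (f w) * complex.Re (g w) -
    complex.Im (f w) * complex.Im (g w))).
    by apply: measurable_funB; exact: measurable_funM.
  by apply/funext => w; case: (f w); case: (g w).
- rewrite (_ : (fun _ => _) = (fun w => complex.Re (f w) * complex.Im (g w) +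
    complex.Im (f w) * complex.Re (g w))).
    by apply: measurable_funD; exact: measurable_funM.
  by apply/funext => w; case: (f w); case: (g w).
Qed.

Lemma cmeasurable_cst c : cmeasurable (cst c).
Proof. by split; exact: measurable_cst. Qed.

Lemma cmeasurableZ c f : cmeasurable f -> cmeasurable (fun w => c * f w).
Proof. by move=> mf; apply: cmeasurableM => //; exact: cmeasurable_cst. Qed.

Lemma cmeasurableB f g : cmeasurable f -> cmeasurable g ->
  cmeasurable (fun w => f w - g w).
Proof.
move=> mf mg; rewrite (_ : (fun _ => _) = (fun w => f w + -1 * g w)).
  by apply: cmeasurableD => //; exact: cmeasurableZ.
by apply/funext => w; rewrite mulN1r.
Qed.

Lemma measurable_normc f : cmeasurable f ->
  measurable_fun setT (fun w => Normc.normc (f w)).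
Proof.
move=> [rf jf].
rewrite (_ : (fun _ => _) = Num.sqrt \o
    (fun w => complex.Re (f w) ^+ 2 + complex.Im (f w) ^+ 2)).
  apply: measurableT_comp.
    by apply: continuous_measurable_fun; exact: sqrt_continuous.
  by apply: measurable_funD; exact: measurable_funX.
by apply/funext => w; rewrite normc_ReIm.
Qed.

Local Open Scope ereal_scope.

Lemma measurable_normc_powR p f : cmeasurable f ->
  measurable_fun setT (fun w => (Normc.normc (f w) `^ p)%:E).
Proof.
move=> mf; apply/measurable_EFinP.
apply: (@measurableT_comp _ _ _ _ _ _ (@powR R ^~ p)) => //.
exact: measurable_normc.
Qed.

Lemma cLnorm_ge0 q f : 0 <= cLnorm mu q f.
Proof. exact: Lnorm_ge0. Qed.

Lemma cLnormE p f :
  cLnorm mu p%:E f = (\int[mu]_w ((Normc.normc (f w)) `^ p)%:E) `^ p^-1.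
Proof.
rewrite /cLnorm unlock; congr (_ `^ _).
by apply: eq_integral => w _; rewrite /= ger0_norm ?normc_ge0.
Qed.

Lemma eq_cLnorm q f g : (forall w, Normc.normc (f w) = Normc.normc (g w)) ->
  cLnorm mu q f = cLnorm mu q g.
Proof. by move=> fg; apply: eq_Lnorm => w; rewrite fg. Qed.

Lemma le_cLnorm p f g : (0 < p)%R -> cmeasurable f -> cmeasurable g ->
  (forall w, (Normc.normc (f w) <= Normc.normc (g w))%R) ->
  cLnorm mu p%:E f <= cLnorm mu p%:E g.
Proof.
move=> p0 mf mg fg; rewrite !cLnormE.
apply: gt0_ler_poweR.
- by rewrite invr_ge0 ltW.
- by rewrite in_itv/= leey integral_ge0// => w _; rewrite lee_fin powR_ge0.
- by rewrite in_itv/= leey integral_ge0// => w _; rewrite lee_fin powR_ge0.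
apply: ge0_le_integral => //; do ?[exact: measurable_normc_powR].
- by move=> w _; rewrite lee_fin powR_ge0.
- by move=> w _; rewrite lee_fin ge0_ler_powR// ?nnegrE ?normc_ge0// ltW.
Qed.

Lemma cLnormD p f g : (1 <= p)%R -> cmeasurable f -> cmeasurable g ->
  cLnorm mu p%:E (fun w => (f w + g w)%R) <=
  cLnorm mu p%:E f + cLnorm mu p%:E g.
Proof.
move=> p1 mf mg.
have p0 : (0 < p)%R by rewrite (lt_le_trans _ p1).
have mfn := measurable_normc mf; have mgn := measurable_normc mg.
apply: le_trans (minkowski_EFin mu mfn mgn p1).
(* Minkowski is available for real functions only: it is applied to |f| and |g|, and the real
   function |f| + |g| is viewed as the complex function [h] so that [le_cLnorm] compares it with f +
   g. *)
pose h w := Complex (Normc.normc (f w) + Normc.normc (g w))%R 0%R.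
have hE w : Normc.normc (h w) = (Normc.normc (f w) + Normc.normc (g w))%R.
  by rewrite normc_complexr ger0_norm// addr_ge0// normc_ge0.
have mh : cmeasurable h.
  by split; [exact: measurable_funD|exact: measurable_cst].
apply: (@le_trans _ _ (cLnorm mu p%:E h)).
  apply: le_cLnorm => // [|w]; first exact: cmeasurableD.
  by rewrite hE le_normcD.
by rewrite /cLnorm le_eqVlt; apply/orP; left; apply/eqP/eq_Lnorm => w; rewrite hE.
Qed.

Lemma cLnormZ p c f : (0 < p)%R -> cmeasurable f ->
  cLnorm mu p%:E (fun w => (c * f w)%R) =
  (Normc.normc c)%:E * cLnorm mu p%:E f.
Proof.
move=> p0 mf; rewrite !cLnormE.
under eq_integral do rewrite Normc.normcM powRM ?normc_ge0// EFinM.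
rewrite ge0_integralZl_EFin ?powR_ge0//.
- rewrite poweRM; last 2 first.
  + by rewrite lee_fin powR_ge0.
  + by rewrite integral_ge0// => w _; rewrite lee_fin powR_ge0.
  by rewrite poweR_EFin -powRrM divff ?gt_eqF// powRr1// normc_ge0.
- by move=> w _; rewrite lee_fin powR_ge0.
- exact: measurable_normc_powR.
Qed.

Lemma cLpD p f g : (1 <= p)%R -> cLp mu p%:E f -> cLp mu p%:E g ->
  cLp mu p%:E (fun w => (f w + g w)%R).
Proof.
move=> p1 [rf jf nf] [rg jg ng].
have [mr mi] := @cmeasurableD f g (conj rf jf) (conj rg jg).
by split=> //; apply: le_lt_trans (cLnormD _ _ _) _ => //; exact: lte_add_pinfty.
Qed.

Lemma cLpZ p c f : (0 < p)%R -> cLp mu p%:E f ->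
  cLp mu p%:E (fun w => (c * f w)%R).
Proof.
move=> p0 [rf jf nf]; have [mr mi] := @cmeasurableZ c f (conj rf jf).
split=> //; rewrite cLnormZ//.
by rewrite lte_mul_pinfty// lee_fin normc_ge0.
Qed.

Lemma cLnorm_eq0 p f : (0 < p)%R -> cmeasurable f ->
  cLnorm mu p%:E f = 0 <-> {ae mu, forall w, f w = 0%R}.
Proof.
move=> p0 mf; have mn := measurable_normc mf; split.
  move=> /Lnorm_eq0_eq0 h.
  have {}h := h (iffRL (measurable_EFinP _ _) mn) p0.
  by apply: filterS h => w /(_ I)[] /Normc.eq0_normc.
move=> f0; rewrite cLnormE (_ : \int[mu]_w _ = 0) ?poweR0r ?invr_neq0 ?gt_eqF//.
  rewrite -(integral0 mu setT); apply: ae_eq_integral => //.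
    exact: measurable_normc_powR.
  apply: filterS f0 => w -> _.
  by rewrite Normc.normc0 powR0// gt_eqF.
Qed.

Lemma cLnorm2_sqr f :
  cLnorm mu 2%:E f ^+ 2 =
  \int[mu]_w (complex.Re (f w) ^+ 2 + complex.Im (f w) ^+ 2)%:E.
Proof.
rewrite -poweRe2 ?cLnorm_ge0// powR_Lnorm//; apply: eq_integral => w _.
rewrite poweRe2 ?abse_ge0// -EFin_expe/= real_normK ?sqr_normc_ReIm//.
by rewrite num_real.
Qed.

(* The triangle inequality in L^(q/2) for |F|^2 = (Re F)^2 + (Im F)^2. *)
Lemma cLnorm_sqr_le (q : R) f : (2 <= q)%R -> cmeasurable f ->
  cLnorm mu q%:E f ^+ 2 <=
  cLnorm mu q%:E (fun w => Complex (complex.Re (f w)) 0%R) ^+ 2 +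
  cLnorm mu q%:E (fun w => Complex (complex.Im (f w)) 0%R) ^+ 2.
Proof.
move=> q2 [mr mi].
have q0 : (0 < q)%R by rewrite (lt_le_trans _ q2).
have sqrE g : cLnorm mu q%:E g ^+ 2 =
    Lnorm mu (q / 2)%:E (fun w => (Normc.normc (g w) ^+ 2)%:E).
  rewrite -poweRe2 ?cLnorm_ge0// cLnormE -poweRrM unlock.
  rewrite (_ : (q^-1 * 2 = (q / 2)^-1)%R); last by rewrite invfM invrK.
  congr (_ `^ _); apply: eq_integral => w _ /=; rewrite ger0_norm ?sqr_ge0//.
  rewrite -powR_mulrn ?normc_ge0// -powRrM; congr (_ `^ _)%:E.
  by rewrite mulrC divfK.
rewrite !sqrE.
have := minkowski_EFin mu (measurable_funX 2 mr) (measurable_funX 2 mi)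
  (_ : 1 <= q / 2)%R.
rewrite ler_pdivlMr// mul1r => /(_ q2); congr (_ <= _ + _); apply: eq_Lnorm => w.
- by rewrite sqr_normc_ReIm.
- by rewrite sqr_normc_ReIm/= expr0n/= addr0.
- by rewrite sqr_normc_ReIm/= expr0n/= addr0.
Qed.

End complex_valued.

(** * The reflection on [S] and its effect on measures and integrals *)

Definition negS (R : realType) N (S : set 'rV[R]_N) (w : onset S) : onset S :=
  - (w : 'rV[R]_N).

Definition flip (R : realType) N (S : set 'rV[R]_N) (f : onset S -> R[i]) :
  onset S -> R[i] := fun w => conjc (f (negS w)).

Section reflection.
Context (R : realType) (N : nat) (S : set 'rV[R]_N).
Hypothesis S_sym : S = [set - x | x in S].

(** Although [S] need not be Borel, it has the same trace on itself as the whole space. *)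
Lemma measurable_onset : measurable (S : set (onset S)).
Proof. by exists setT => //; rewrite setIid setTI. Qed.

Lemma negSK (w : onset S) : negS (negS w) = w.
Proof. exact: opprK. Qed.

Lemma preimage_negS : (@negS R N S) @^-1` S = S.
Proof.
apply/seteqP; split=> w Sw; rewrite S_sym; last by exists w.
by exists (negS w) => //; exact: negSK.
Qed.

(** The reflection is continuous on R^N, hence Borel, and as [S] is its own preimage, an identity of
    traces on [S] pulls back to an identity of traces on [S]. *)
Lemma measurable_negS : measurable_fun setT (@negS R N S).
Proof.
move=> _ A [B mB AB]; rewrite setTI.
have mN : measurable_fun setT (-%R : borelRV R N -> borelRV R N).
  apply: (@measurability _ _ _ _ setT (-%R : borelRV R N -> borelRV R N)
    (@open 'rV[R]_N : set (set (borelRV R N)))) => // _ [U oU <-].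
  rewrite setTI; apply: sub_sigma_algebra.
  by apply: open_comp => // v _; exact: opp_continuous.
exists ((-%R : borelRV R N -> borelRV R N) @^-1` B).
  by rewrite -[X in measurable X]setTI; exact: mN.
have := congr1 (fun C => @negS R N S @^-1` C) AB.
by rewrite !preimage_setI preimage_negS.
Qed.

Lemma measurable_comp_negS d' (U : measurableType d') (f : onset S -> U) :
  measurable_fun setT f -> measurable_fun setT (f \o @negS R N S).
Proof. by move=> mf; apply: measurableT_comp => //; exact: measurable_negS. Qed.

Lemma cmeasurable_flip (f : onset S -> R[i]) :
  cmeasurable f -> cmeasurable (flip f).
Proof.
move=> [mr mi]; split.
- rewrite (_ : (fun _ => _) = (fun w => complex.Re (f w)) \o @negS R N S).
    exact: measurable_comp_negS.
  by apply/funext => w; rewrite /flip/=; case: (f _).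
- rewrite (_ : (fun _ => _) = -%R \o ((fun w => complex.Im (f w)) \o @negS R N S)).
    by apply: measurableT_comp => //; exact: measurable_comp_negS.
  by apply/funext => w; rewrite /flip/=; case: (f _).
Qed.

Lemma flipK (f : onset S -> R[i]) : flip (flip f) = f.
Proof. by apply/funext => w; rewrite /flip negSK conjcK. Qed.

Variable mu : {measure set (onset S) -> \bar R}.
Hypothesis mu_on_S : mu (~` S) = 0%E.
Hypothesis mu_sym : forall A : set 'rV[R]_N,
  measurable (A : set (onset S)) -> A `<=` S ->
  mu A = mu [set - x | x in A].
Local Open Scope ereal_scope.

Lemma measure_negS (A : set (onset S)) : measurable A ->
  mu (@negS R N S @^-1` A) = mu A.
Proof.
(* The symmetry hypothesis covers subsets of [S] only; since the complement of [S] is null, every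
   set may first be cut down to [S]. *)
have muS (B : set (onset S)) : measurable B -> mu B = mu (B `&` S).
  move=> mB; rewrite -[in LHS](setUIDK B S) measureU//.
  - rewrite [X in _ + X](_ : _ = 0) ?adde0//.
    apply/eqP; rewrite -measure_le0 -mu_on_S le_measure ?inE//.
    + exact: measurableD mB measurable_onset.
    + exact: measurableC measurable_onset.
  - exact: measurableI mB measurable_onset.
  - exact: measurableD mB measurable_onset.
  - by apply/seteqP; split=> // w [[_ Sw] [_]].
move=> mA; rewrite [RHS]muS// muS; last first.
  by rewrite -[X in measurable X]setTI; exact: measurable_negS.
rewrite [RHS]mu_sym//; last first.
  exact: measurableI mA measurable_onset.
congr (mu _); apply/seteqP; split=> [w [Aw Sw]|_ [w [Aw Sw] <-]].
  exists (negS w); last exact: negSK.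
  by split=> //; rewrite -preimage_negS/= /preimage/= negSK.
split; first by rewrite /= [negS _]negSK.
by rewrite S_sym; exists w.
Qed.

(** By [measure_negS] the pushforward of [mu] under the reflection is [mu]. A general invariant [D]
    serves both uses: the whole space for norms, [S] for the transform. *)
Lemma ge0_integral_negS (D : set (onset S)) (f : onset S -> \bar R) :
  measurable D -> @negS R N S @^-1` D = D -> measurable_fun setT f ->
  (forall w, 0 <= f w) ->
  \int[mu]_(w in D) f (negS w) = \int[mu]_(w in D) f w.
Proof.
move=> mD ND mf f0; rewrite -[in LHS]ND.
rewrite -[LHS](ge0_integral_pushforward measurable_negS)//.
- apply: eq_measure_integral; first exact: measurable_negS.
  by move=> ? A mA _; exact: measure_negS.
- exact: measurable_funTS.
Qed.

Lemma integral_negS (D : set (onset S)) (f : onset S -> \bar R) :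
  measurable D -> @negS R N S @^-1` D = D -> measurable_fun setT f ->
  \int[mu]_(w in D) f (negS w) = \int[mu]_(w in D) f w.
Proof.
move=> mD ND mf; rewrite integralE [RHS]integralE.
congr (_ - _).
- rewrite -[RHS](ge0_integral_negS mD ND (measurable_funepos mf)); last first.
    by move=> w; exact: funepos_ge0.
  by apply: eq_integral => w _; rewrite !funeposE.
- rewrite -[RHS](ge0_integral_negS mD ND (measurable_funeneg mf)); last first.
    by move=> w; exact: funeneg_ge0.
  by apply: eq_integral => w _; rewrite !funenegE.
Qed.

Lemma Rintegral_negS (f : onset S -> R) : measurable_fun setT f ->
  (\int[mu]_(w in S) f (negS w) = \int[mu]_(w in S) f w)%R.
Proof.
move=> mf; congr fine; rewrite (@integral_negS S (EFin \o f))//.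
- exact: measurable_onset.
- exact: preimage_negS.
- exact/measurable_EFinP.
Qed.

Lemma cLnorm_flip (p : R) (f : onset S -> R[i]) : cmeasurable f ->
  cLnorm mu p%:E (flip f) = cLnorm mu p%:E f.
Proof.
move=> mf; rewrite !cLnormE; congr (_ `^ _).
rewrite -[RHS]ge0_integral_negS//.
- by apply: eq_integral => w _; rewrite normc_conjc.
- exact: measurable_normc_powR.
- by move=> w; rewrite lee_fin powR_ge0.
Qed.

Lemma cLp_flip (p : R) (f : onset S -> R[i]) :
  cLp mu p%:E f -> cLp mu p%:E (flip f).
Proof.
move=> [mr mi nf].
have [mr' mi'] := @cmeasurable_flip f (conj mr mi).
by split=> //; rewrite cLnorm_flip.
Qed.

End reflection.

(** * Continuity of integrals depending on a parameter *)

(** Dominated convergence speaks of sequences, so continuity is reduced to them: if it failed at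
    [a], points chosen in the balls of radius 1/(n+1) would form a sequence tending to [a] whose
    images stay away from [F a]. *)
Lemma seq_continuous (R : realType) (V : pseudoMetricType R) (F : V -> R)
    (a : V) :
  (forall u : nat -> V, u n @[n --> \oo] --> a -> F (u n) @[n --> \oo] --> F a) ->
  {for a, continuous F}.
Proof.
move=> h; apply/cvgrPdist_lt => e e0; apply: contrapT => nF.
have /choice[u uP] : forall n : nat, exists x,
    ball a n.+1%:R^-1 x /\ ~ `|F a - F x| < e.
  move=> n; apply: contrapT => /forallNP nx; apply: nF.
  apply/nbhs_ballP; exists n.+1%:R^-1; first by rewrite /= invr_gt0.
  by move=> x ax; apply: contrapT => Fx; exact: nx x (conj ax Fx).
have /h/cvgrPdist_lt/(_ _ e0)[n _] : u n @[n --> \oo] --> a.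
  apply/cvg_ballP => d d0; near=> n.
  have [+ _] := uP n; apply: le_ball; apply: ltW; near: n.
  exact: near_infty_natSinv_lt (PosNum d0).
by move=> /(_ n (leqnn n)); have [] := uP n.
Unshelve. all: by end_near. Qed.

Lemma continuous_borelRV_measurable (R : realType) n (F : 'rV[R]_n -> R) :
  continuous F -> measurable_fun setT (F : borelRV R n -> R).
Proof.
move=> cF; apply: (measurability _ (RGenOpens.measurableE R)).
move=> _ [_ [a [b ->]] <-]; rewrite setTI; apply: sub_sigma_algebra.
by apply: open_comp; [move=> v _; exact: cF|exact: interval_open].
Qed.

Lemma continuous_Rintegral (R : realType) (V : pseudoMetricType R) d
    (T : measurableType d) (mu : {measure set T -> \bar R}) (D : set T)
    (k : V -> T -> R) (g : T -> R) : measurable D ->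
  (forall w, continuous (k ^~ w)) -> (forall x, measurable_fun D (k x)) ->
  mu.-integrable D (EFin \o g) -> (forall x w, `|k x w| <= g w) ->
  continuous (fun x => \int[mu]_(w in D) k x w).
Proof.
move=> mD ck mk ig kg a; apply: seq_continuous => u ua.
have [] := @dominated_convergence _ _ _ mu D mD
  (fun n w => (k (u n) w)%:E) (fun w => (k a w)%:E) (EFin \o g).
- by move=> n; exact/measurable_EFinP.
- exact/measurable_EFinP.
- apply/aeW => w _; apply: cvg_EFin; first exact: nearW.
  exact: (cvg_comp _ _ ua (ck w a)).
- exact: ig.
- by apply/aeW => w n _; rewrite lee_fin.
move=> ia _ cvi; apply: fine_cvg; rewrite fineK; last exact: integrable_fin_num.
exact: cvi.
Qed.

(** * Linearity of the complex integral *)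

Section cintegral_linear.
Context d (T : measurableType d) (R : realType).
Variables (mu : {measure set T -> \bar R}) (D : set T).
Hypothesis mD : measurable D.
Implicit Types f g : T -> R[i].

Lemma cLp1_integrable f : cLp mu 1%:E f ->
  [/\ mu.-integrable D (fun w => (complex.Re (f w))%:E),
      mu.-integrable D (fun w => (complex.Im (f w))%:E) &
      mu.-integrable D (fun w => (Normc.normc (f w))%:E)].
Proof.
move=> [mr mi nf].
have mn : measurable_fun setT (fun w => Normc.normc (f w)).
  exact: (@measurable_normc _ _ _ f (conj mr mi)).
have iN : mu.-integrable setT (fun w => (Normc.normc (f w))%:E).
  apply/integrableP; split; first exact/measurable_EFinP.
  by rewrite /cLnorm Lnorm1 in nf.
split.
- apply: (integrableS measurableT mD) => //.
  apply: le_integrable iN => //; first exact/measurable_EFinP.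
  by move=> w _; rewrite lee_fin [leRHS]ger0_norm ?normc_ge0// ler_Re_normc.
- apply: (integrableS measurableT mD) => //.
  apply: le_integrable iN => //; first exact/measurable_EFinP.
  by move=> w _; rewrite lee_fin [leRHS]ger0_norm ?normc_ge0// ler_Im_normc.
- exact: integrableS measurableT mD _ iN.
Qed.

Lemma cintegralD f g : cLp mu 1%:E f -> cLp mu 1%:E g ->
  cintegral mu D (fun w => f w + g w) = cintegral mu D f + cintegral mu D g.
Proof.
move=> /cLp1_integrable[fr fi _] /cLp1_integrable[gr gi _].
rewrite /cintegral/= -[RHS]/(Complex (_ + _) (_ + _)) -!RintegralD//.
by congr Complex; apply: eq_Rintegral => w _; case: (f w); case: (g w).
Qed.

Lemma cintegralZ (c : R[i]) f : cLp mu 1%:E f ->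
  cintegral mu D (fun w => c * f w) = c * cintegral mu D f.
Proof.
move=> /cLp1_integrable[fr fi _]; case: c => a b.
have iZ (r : R) (h : T -> R) : mu.-integrable D (EFin \o h) ->
  mu.-integrable D (EFin \o (fun w => r * h w)) by exact: integrableZl.
rewrite /cintegral/= -[RHS]/(Complex (_ - _) (_ + _)).
rewrite -!RintegralZl// -RintegralB//; try exact: iZ.
rewrite -RintegralD//; try exact: iZ.
by congr Complex; apply: eq_Rintegral => w _; case: (f w).
Qed.

End cintegral_linear.

(** * The transform: linearity, measurability, behaviour under reflection *)

Section fcheck_theory.
Context (R : realType) (N : nat) (S : set 'rV[R]_N).
Variable sigma : {measure set (onset S) -> \bar R}.
Implicit Types x : 'rV[R]_N.
Implicit Types f g : onset S -> R[i].

Lemma normc_expi (t : R) : Normc.normc (expi t) = 1.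
Proof. by rewrite normc_ReIm/= cos2Dsin2 sqrtr1. Qed.

Lemma dotVN (x w : 'rV[R]_N) : dotV x (- w) = - dotV x w.
Proof. by rewrite /dotV -sumrN; apply: eq_bigr => i _; rewrite mxE mulrN. Qed.

Lemma continuous_dotV (w : 'rV[R]_N) : continuous (fun x => dotV x w).
Proof.
rewrite /dotV; apply: (@continuous_big _ _ +%R) => [|i _ x]; first exact: add_continuous.
by apply: (@continuousM _ 'rV[R]_N); [exact: coord_continuous|exact: cst_continuous].
Qed.

(** The real and imaginary parts of e^(i x.w) f(w) have this form, with (a, b) equal to (Re f, - Im
    f) and (Im f, Re f). *)
Lemma continuous_phase (a b : R) (w : 'rV[R]_N) :
  continuous (fun x => cos (dotV x w) * a + sin (dotV x w) * b).
Proof.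
move=> x; apply: (@continuousD _ _ 'rV[R]_N);
  apply: (@continuousM _ 'rV[R]_N); do ?exact: cst_continuous.
- apply: (@continuous_comp 'rV[R]_N); first exact: continuous_dotV.
  exact: continuous_cos.
- apply: (@continuous_comp 'rV[R]_N); first exact: continuous_dotV.
  exact: continuous_sin.
Qed.

Lemma measurable_dotV (x : 'rV[R]_N) :
  measurable_fun setT (fun w : onset S => dotV x w).
Proof.
apply: measurable_sum => i; apply: measurable_funM => //.
move=> _ A mA; rewrite setTI.
exists [set w : borelRV R N | A ((w : 'rV[R]_N) 0 i)] => //.
by rewrite -[X in measurable X]setTI; exact: measurable_coordRV.
Qed.

Lemma cmeasurable_phase x f : cmeasurable f ->
  cmeasurable (fun w : onset S => expi (dotV x w) * f w).
Proof.
move=> mf; apply: cmeasurableM => //; split.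
  apply: (@measurableT_comp _ _ _ _ _ _ (@cos R)).
    by apply: continuous_measurable_fun; exact: continuous_cos.
  exact: measurable_dotV.
apply: (@measurableT_comp _ _ _ _ _ _ (@sin R)).
  by apply: continuous_measurable_fun; exact: continuous_sin.
exact: measurable_dotV.
Qed.

Lemma cLp_phase (q : \bar R) x f : cLp sigma q f ->
  cLp sigma q (fun w : onset S => expi (dotV x w) * f w).
Proof.
move=> [mr mi nf]; have [mr' mi'] := @cmeasurable_phase x f (conj mr mi).
split=> //; rewrite (@eq_cLnorm _ _ _ _ _ _ f)// => w.
by rewrite Normc.normcM normc_expi mul1r.
Qed.

Lemma fcheckD f g : cLp sigma 1%:E f -> cLp sigma 1%:E g ->
  fcheck sigma (fun w => f w + g w) = (fun x => fcheck sigma f x + fcheck sigma g x).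
Proof.
move=> lf lg; apply/funext => x; rewrite /fcheck.
under [in LHS]eq_fun do rewrite mulrDr.
by rewrite cintegralD//; [exact: measurable_onset|exact: cLp_phase..].
Qed.

Lemma fcheckZ (c : R[i]) f : cLp sigma 1%:E f ->
  fcheck sigma (fun w => c * f w) = (fun x => c * fcheck sigma f x).
Proof.
move=> lf; apply/funext => x; rewrite /fcheck.
under [in LHS]eq_fun do rewrite mulrCA.
by rewrite cintegralZ//; [exact: measurable_onset|exact: cLp_phase].
Qed.

(** The transform of an L^1 function is continuous, hence Borel: its integrand is continuous in x
    and, the phase having modulus 1, dominated by |f|. Measurability is what the triangle inequality
    in L^q requires of transforms. *)
Lemma cmeasurable_fcheck f : cLp sigma 1%:E f ->
  cmeasurable (fcheck sigma f : borelRV R N -> R[i]).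
Proof.
move=> lf; have [_ _ iN] := cLp1_integrable (@measurable_onset R N S) lf.
have mp x := cmeasurable_phase x (cLp_cmeasurable lf).
split; apply: continuous_borelRV_measurable.
- apply: continuous_Rintegral iN _.
  + exact: measurable_onset.
  + move=> w; rewrite (_ : (fun _ => _) = (fun x => cos (dotV x w) *
      complex.Re (f w) + sin (dotV x w) * (- complex.Im (f w)))).
      exact: continuous_phase.
    by apply/funext => y; case: (f w) => a b /=; rewrite mulrN.
  + by move=> x; apply: measurable_funTS; case: (mp x).
  + move=> x w; rewrite (le_trans (ler_Re_normc _))//.
    by rewrite Normc.normcM normc_expi mul1r.
- apply: continuous_Rintegral iN _.
  + exact: measurable_onset.
  + move=> w; rewrite (_ : (fun _ => _) = (fun x => cos (dotV x w) *
      complex.Im (f w) + sin (dotV x w) * complex.Re (f w))).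
      exact: continuous_phase.
    by apply/funext => y; case: (f w) => a b /=.
  + by move=> x; apply: measurable_funTS; case: (mp x).
  + move=> x w; rewrite (le_trans (ler_Im_normc _))//.
    by rewrite Normc.normcM normc_expi mul1r.
Qed.

Hypothesis S_sym : S = [set - x | x in S].
Hypothesis sigma_on_S : sigma (~` S) = 0%E.
Hypothesis sigma_sym : forall A : set 'rV[R]_N,
  measurable (A : set (onset S)) -> A `<=` S ->
  sigma A = sigma [set - x | x in A].

Lemma fcheck_flip f : cLp sigma 1%:E f ->
  fcheck sigma (flip f) = (fun x => conjc (fcheck sigma f x)).
Proof.
move=> lf; apply/funext => x; rewrite /fcheck.
pose k w := expi (dotV x w) * f w.
have lk : cLp sigma 1%:E k by exact: cLp_phase.
have [kr ki _] := cLp1_integrable (@measurable_onset R N S) lk.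
have [mr mi _] := lk.
(* The phase is invariant under reflection followed by conjugation, because
   [dotV x (- w) = - dotV x w]; so the integrand for [flip f] is the flip of the integrand [k] for
   f. *)
rewrite [in LHS](_ : (fun _ => _) = flip k); last first.
  apply/funext => w; rewrite /flip /k rmorphM/=; congr (_ * _).
  by rewrite /negS dotVN /expi/= cosN sinN opprK.
rewrite /cintegral -[RHS]/(Complex _ (- _)); congr Complex.
- rewrite -[RHS](Rintegral_negS S_sym sigma_on_S sigma_sym mr).
  by apply: eq_Rintegral => w _; rewrite /flip; case: (k _).
- rewrite -mulN1r -RintegralZl//; last exact: measurable_onset.
  rewrite -[RHS](Rintegral_negS S_sym sigma_on_S sigma_sym); last first.
    exact: measurable_funM.
  apply: eq_Rintegral => w _; rewrite mulN1r -/(k (negS w)) /flip.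
  by case: (k (negS w)).
Qed.

End fcheck_theory.

(** * Real and imaginary parts as complex numbers *)

Section complex_parts.
Context (R : realType).
Local Open Scope complex_scope.

Lemma Complex_Re (z : R[i]) : Complex (complex.Re z) 0 = 2^-1 * (z + conjc z).
Proof.
have -> : z + conjc z = 2 * Complex (complex.Re z) 0.
  rewrite mulr_natl mulr2n; case: z => a b.
  by rewrite -[LHS]/(Complex _ _) -[RHS]/(Complex _ _)/= subrr addr0.
by rewrite mulKf// pnatr_eq0.
Qed.

Lemma Complex_ReB (z y : R[i]) : Complex (complex.Re z) 0 -
  Complex (complex.Re y) 0 = Complex (complex.Re (z - y)) 0.
Proof.
case: z y => a b [c d] /=.
by rewrite -[LHS]/(Complex _ _) -[RHS]/(Complex _ _)/= subrr.
Qed.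

(** Reduces imaginary parts to real parts, so that every statement about the second symmetric part
    follows from the one about the first, applied to - i f. *)
Lemma Complex_Im (z : R[i]) :
  Complex (complex.Im z) 0 = Complex (complex.Re (- 'i * z)) 0.
Proof. by case: z => a b /=; congr Complex; rewrite oppr0 mul0r mulN1r sub0r opprK. Qed.

Lemma normcNi : Normc.normc (- 'i : R[i]) = 1.
Proof. by rewrite normc_ReIm/= oppr0 expr0n/= add0r sqrrN expr1n sqrtr1. Qed.

Lemma conjcM (x y : R[i]) : conjc (x * y) = conjc x * conjc y.
Proof. exact: rmorphM. Qed.

Lemma conjcD (x y : R[i]) : conjc (x + y) = conjc x + conjc y.
Proof. exact: rmorphD. Qed.

Lemma conjcB (x y : R[i]) : conjc (x - y) = conjc x - conjc y.
Proof. exact: rmorphB. Qed.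

Lemma conjcNi : conjc (- 'i) = 'i :> R[i].
Proof. by rewrite /conjc/= opprK oppr0. Qed.

Lemma conjc2V : conjc (2^-1 : R[i]) = 2^-1.
Proof. by rewrite conjc_inv conjc_nat. Qed.

Lemma normc2V : Normc.normc (2^-1 : R[i]) = 2^-1.
Proof.
by rewrite Normc.normcV -[2]/(1 *+ 2) normcMn Normc.normc1.
Qed.

End complex_parts.

(** * The two symmetric parts of a function *)

(** The projection onto symmetric functions: g is [symr f], and h is [symr] of - i f. *)
Definition symr (R : realType) N (S : set 'rV[R]_N) (f : onset S -> R[i]) :
  onset S -> R[i] := fun w => 2^-1 * (f w + flip f w).

Section symmetrization.
Context (R : realType) (N : nat) (S : set 'rV[R]_N).
Hypothesis S_sym : S = [set - x | x in S].
Implicit Types f g : onset S -> R[i].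

Lemma flip_symr f : flip (symr f) = symr f.
Proof.
apply/funext => w; rewrite /symr {1}/flip conjcM conjcD conjc2V.
rewrite -[conjc (flip f (negS w))]/(flip (flip f) w) flipK.
by rewrite -[conjc (f (negS w))]/(flip f w) [in LHS]addrC.
Qed.

Lemma symrB f g w : symr f w - symr g w = symr (fun w => f w - g w) w.
Proof.
by rewrite /symr /flip conjcB -mulrBr opprD addrACA.
Qed.

(** Conjugation turns - i into i, so the second summand equals (f - [flip f]) / 2, the antisymmetric
    half of f. *)
Lemma symr_decomp f w :
  f w = symr f w + 'i%C * symr (fun w => - 'i%C * f w) w.
Proof.
rewrite /symr /flip conjcM conjcNi.
set z := f w; set y := conjc _.
have ii : 'i%C * 'i%C = -1 :> R[i] by rewrite -expr2 sqr_i.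
have -> : 'i%C * (2^-1 * (- 'i%C * z + 'i%C * y)) =
    2^-1 * ('i%C * 'i%C * y - 'i%C * 'i%C * z) by ring.
by rewrite ii; field.
Qed.

Lemma cmeasurable_symr f : cmeasurable f -> cmeasurable (symr f).
Proof.
by move=> mf; apply/cmeasurableZ/cmeasurableD => //; exact: cmeasurable_flip.
Qed.

Variable mu : {measure set (onset S) -> \bar R}.
Hypothesis mu_on_S : mu (~` S) = 0%E.
Hypothesis mu_sym : forall A : set 'rV[R]_N,
  measurable (A : set (onset S)) -> A `<=` S ->
  mu A = mu [set - x | x in A].
Local Open Scope ereal_scope.

(** [symr f] averages two functions of equal norm. This contraction also lets the symmetric parts of
    an approximating sequence converge. *)
Lemma le_cLnorm_symr (p : R) f : (1 <= p)%R -> cmeasurable f ->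
  cLnorm mu p%:E (symr f) <= cLnorm mu p%:E f.
Proof.
move=> p1 mf; have p0 : (0 < p)%R by rewrite (lt_le_trans _ p1).
have mff := cmeasurable_flip S_sym mf.
rewrite cLnormZ//; last exact: cmeasurableD.
rewrite normc2V lee_pdivrMl// (le_trans (cLnormD mu p1 mf mff))//.
by rewrite cLnorm_flip// mule_natl mule2n.
Qed.

Lemma cLp_symr (p : R) f : (1 <= p)%R -> cLp mu p%:E f -> cLp mu p%:E (symr f).
Proof.
move=> p1 lf; have [mr mi nf] := lf; have mf := cLp_cmeasurable lf.
have [mr' mi'] := cmeasurable_symr mf.
by split=> //; exact: le_lt_trans (le_cLnorm_symr p1 mf) nf.
Qed.

(* Pointwise, the squared moduli of the two symmetric parts of f add up to the
   average of |f|^2 and its reflection. *)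
Lemma cLnorm2_symr f : cmeasurable f ->
  cLnorm mu 2%:E f ^+ 2 = cLnorm mu 2%:E (symr f) ^+ 2 +
    cLnorm mu 2%:E (symr (fun w => (- 'i%C * f w)%R)) ^+ 2.
Proof.
move=> mf; rewrite !cLnorm2_sqr.
have msq h : cmeasurable h -> measurable_fun setT
    (fun w : onset S => (complex.Re (h w) ^+ 2 + complex.Im (h w) ^+ 2)%:E).
  by move=> [mr mi]; apply/measurable_EFinP/measurable_funD;
    exact: measurable_funX.
rewrite -ge0_integralD//; last 4 first.
- by move=> w _; rewrite lee_fin addr_ge0// sqr_ge0.
- exact/msq/cmeasurable_symr.
- by move=> w _; rewrite lee_fin addr_ge0// sqr_ge0.
- exact/msq/cmeasurable_symr/cmeasurableZ.
(* [A] is half of |f|^2. One of its two copies is reflected, after which the integrands agree by the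
   parallelogram law for f(w) and its flip. *)
pose A w := (2^-1 * (complex.Re (f w) ^+ 2 + complex.Im (f w) ^+ 2))%:E.
have mA : measurable_fun setT A.
  by apply/measurable_EFinP/measurable_funM => //; exact/measurable_EFinP/msq.
have A0 w : 0 <= A w by rewrite lee_fin mulr_ge0// addr_ge0// sqr_ge0.
transitivity (\int[mu]_w (A w + A w)).
  by apply: eq_integral => w _; rewrite /A -EFinD; congr EFin; field.
transitivity (\int[mu]_w A w + \int[mu]_w A (negS w)).
  by rewrite (ge0_integral_negS S_sym mu_on_S mu_sym)// ge0_integralD.
rewrite -ge0_integralD//; last exact: (measurable_comp_negS S_sym mA).
apply: eq_integral => w _; rewrite /A -!EFinD; congr EFin.
rewrite /symr /flip; case: (f w) => a b; case: (f (negS w)) => a' b'.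
rewrite -!sqr_normc_ReIm !Normc.normcM normc2V !exprMn !sqr_normc_ReIm /=.
by field.
Qed.

End symmetrization.

(** The gaps u^2 - a^2 and v^2 - b^2 are nonnegative with a sum at most 0, so both vanish. This is
    the equality case behind optimizers. *)
Lemma sqr_sum_eq (R : realDomainType) (a b u v : R) :
  0 <= a -> 0 <= b -> a <= u -> b <= v -> u * u + v * v <= a * a + b * b ->
  a = u /\ b = v.
Proof.
move=> a0 b0 au bv uvab.
have uu : a * a <= u * u by rewrite ler_pM.
have vv : b * b <= v * v by rewrite ler_pM.
have u0 := le_trans a0 au; have v0 := le_trans b0 bv.
by split; apply/eqP; rewrite -(@eqrXn2 _ 2)// !expr2 eq_le;
  apply/andP; split=> //; lra.
Qed.

(** * Competitors and their symmetric parts *)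

Section extremizers.
Context (R : realType) (N : nat) (S : set 'rV[R]_N).
Variables (sigma sigma' : {measure set (onset S) -> \bar R}).
Hypothesis sigma_on_S : sigma (~` S) = 0%E.
Hypothesis sigma'_on_S : sigma' (~` S) = 0%E.
Hypothesis S_sym : S = [set - x | x in S].
Hypothesis sigma_sym : forall A : set 'rV[R]_N,
  measurable (A : set (onset S)) -> A `<=` S ->
  sigma A = sigma [set - x | x in A].
Hypothesis sigma'_sym : forall A : set 'rV[R]_N,
  measurable (A : set (onset S)) -> A `<=` S ->
  sigma' A = sigma' [set - x | x in A].
Variable q : R.
Hypothesis hq : 2 <= q.
Implicit Types (f g h : onset S -> R[i]) (F : borelRV R N -> R[i]).
Local Open Scope ereal_scope.

Local Notation leb := (lebesgue_rV R N).
Local Notation "''N2' f" := (cLnorm sigma' 2%:E f) (at level 10, f at level 9).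
Local Notation "''Nq' F" := (cLnorm leb q%:E F) (at level 10, F at level 9).
Local Notation Ni f := (fun w => (- 'i%C * f w)%R).

Let q0 : (0 < q)%R. Proof. by rewrite (lt_le_trans _ hq). Qed.
Let q1 : (1 <= q)%R. Proof. by rewrite (le_trans _ hq)// ler1n. Qed.
Let p1 : (1 <= 2 :> R)%R. Proof. by rewrite ler1n. Qed.

Lemma L1L2_fin_num f : L1L2 sigma sigma' f -> 'N2 f \is a fin_num.
Proof. by move=> [_ [_ _ ?]]; rewrite ge0_fin_numE// cLnorm_ge0. Qed.

Lemma L1L2D f g : L1L2 sigma sigma' f -> L1L2 sigma sigma' g ->
  L1L2 sigma sigma' (fun w => (f w + g w)%R).
Proof. by move=> [f1 f2] [g1 g2]; split; apply: cLpD. Qed.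

Lemma L1L2Z (c : R[i]) f : L1L2 sigma sigma' f ->
  L1L2 sigma sigma' (fun w => (c * f w)%R).
Proof. by move=> [f1 f2]; split; apply: cLpZ. Qed.

Lemma L1L2_symr f : L1L2 sigma sigma' f -> L1L2 sigma sigma' (symr f).
Proof. by move=> [f1 f2]; split; apply: cLp_symr. Qed.

Lemma conj_sym_symr f : conj_sym sigma sigma' (symr f).
Proof.
by split; apply/aeW => w /=; rewrite -[in LHS]flip_symr.
Qed.

Lemma conj_symD f g : conj_sym sigma sigma' f -> conj_sym sigma sigma' g ->
  conj_sym sigma sigma' (fun w => (f w + g w)%R).
Proof.
by move=> [f1 f2] [g1 g2]; split; [apply: filterS2 f1 g1|apply: filterS2 f2 g2]
  => w /= -> ->; rewrite conjcD.
Qed.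

(** Real factors commute with conjugation; natural ones suffice for the perturbations h + n f used
    in [cLnorm_fcheck_sym]. *)
Lemma conj_symZ (n : nat) f : conj_sym sigma sigma' f ->
  conj_sym sigma sigma' (fun w => (n%:R * f w)%R).
Proof.
by move=> [f1 f2]; split; [apply: filterS f1|apply: filterS f2]
  => w /= ->; rewrite conjcM conjc_nat.
Qed.

(** By [fcheck_flip], averaging f with its flip becomes averaging its transform with the complex
    conjugate. *)
Lemma fcheck_symr f : cLp sigma 1%:E f -> fcheck sigma (symr f) =
  (fun x => Complex (complex.Re (fcheck sigma f x)) 0%R).
Proof.
move=> lf; have lff := cLp_flip S_sym sigma_on_S sigma_sym lf.
rewrite /symr fcheckZ; last exact: cLpD.
rewrite fcheckD// fcheck_flip//.
by apply/funext => x; rewrite Complex_Re.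
Qed.

Lemma nonzero_cLnorm f : cLp sigma' 2%:E f ->
  nonzero sigma' f <-> 0 < 'N2 f.
Proof.
move=> /cLp_cmeasurable mf; rewrite lt_def cLnorm_ge0 andbT; split.
  by move=> nf; apply/eqP; rewrite (cLnorm_eq0 sigma' _ mf).
by move/eqP => nf f0; apply: nf; rewrite (cLnorm_eq0 sigma' _ mf).
Qed.

Lemma nonzero_symr f : nonzero sigma' f ->
  nonzero sigma' (symr f) \/ nonzero sigma' (symr (Ni f)).
Proof.
move=> nf; apply/not_andP => -[g0 h0]; apply: nf.
by apply: filterS2 g0 h0 => w g0 h0; rewrite symr_decomp g0 h0 mulr0 addr0.
Qed.

(** Guarantees that the symmetric supremum is not taken over the empty set, where it would be -oo
    and a bound [c] on it could even be negative. *)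
Lemma exists_sym_nonzero f : L1L2 sigma sigma' f -> nonzero sigma' f ->
  exists h, [/\ L1L2 sigma sigma' h, nonzero sigma' h & conj_sym sigma sigma' h].
Proof.
move=> lf /nonzero_symr[] nf; [exists (symr f)|exists (symr (Ni f))];
  by split=> //; [apply: L1L2_symr => //; exact: L1L2Z|exact: conj_sym_symr].
Qed.

Local Notation M := (calM sigma sigma' q%:E).
Local Notation Ms := (calM_sym sigma sigma' q%:E).

(** * From the symmetric bound to all functions: equality of the suprema *)

Lemma ratio_ge0 f F : 0 <= 'Nq F / 'N2 f.
Proof. by rewrite mule_ge0 ?inve_ge0 ?cLnorm_ge0. Qed.

Lemma ratio_le (c : R) f F : 'N2 f \is a fin_num -> 0 < 'N2 f ->
  ('Nq F / 'N2 f <= c%:E) = ('Nq F <= c%:E * 'N2 f).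
Proof.
move=> ffin; rewrite -(fineK ffin) lte_fin => f0.
by rewrite inver gt_eqF// lee_pdivrMr.
Qed.

Lemma cLnorm_fcheck_sym_nonzero (c : R) f : Ms <= c%:E ->
  L1L2 sigma sigma' f -> nonzero sigma' f -> conj_sym sigma sigma' f ->
  'Nq (fcheck sigma f) <= c%:E * 'N2 f.
Proof.
move=> Mc lf nf sf; rewrite -ratio_le ?L1L2_fin_num//; last first.
  exact/(nonzero_cLnorm lf.2).
by apply: le_trans Mc; apply: ereal_sup_ubound; exists f.
Qed.

(* A function that is null for sigma' but not for sigma is not a competitor;
   adding its multiples to a competitor h leaves the L^2(sigma') norm
   unchanged, so that its transform has to vanish. *)
Lemma cLnorm_fcheck_sym (c : R) h f : Ms <= c%:E ->
  L1L2 sigma sigma' h -> nonzero sigma' h -> conj_sym sigma sigma' h ->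
  L1L2 sigma sigma' f -> conj_sym sigma sigma' f ->
  'Nq (fcheck sigma f) <= c%:E * 'N2 f.
Proof.
move=> Mc lh nh sh lf sf.
have [nf|/contrapT f0] := pselect (nonzero sigma' f).
  exact: cLnorm_fcheck_sym_nonzero.
have [lf1 /cLp_cmeasurable mf] := lf; have [lh1 /cLp_cmeasurable mh] := lh.
have Nf0 : 'N2 f = 0 by rewrite (cLnorm_eq0 sigma' _ mf).
rewrite Nf0 mule0.
have mhF := cmeasurable_fcheck lh1; have mfF := cmeasurable_fcheck lf1.
(* The transform of n f is the difference of those of [k] = h + n f and h. Each has norm at most c
   ||h||, as k and h have comparable norms when f is [sigma']-null; hence a bound [K] independent of
   n. *)
pose K := (c * fine ('N2 h) + c * fine ('N2 h))%R.
have c0 : (0 <= c)%R.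
  rewrite -lee_fin (le_trans (ratio_ge0 h (fcheck sigma h)))//.
  by apply: le_trans Mc; apply: ereal_sup_ubound; exists h.
have bound (n : nat) : n%:R%:E * 'Nq (fcheck sigma f) <= K%:E.
  pose k w := (h w + n%:R * f w)%R.
  have lk : L1L2 sigma sigma' k by apply: L1L2D => //; exact: L1L2Z.
  have lk1 := lk.1.
  have sk : conj_sym sigma sigma' k by apply: conj_symD => //; exact: conj_symZ.
  have nk : nonzero sigma' k.
    move=> k0; apply: nh; apply: filterS2 k0 f0 => w + fw.
    by rewrite /k fw mulr0 addr0.
  have kh : 'N2 k <= 'N2 h.
    apply: le_trans (cLnormD sigma' p1 mh (cmeasurableZ _ mf)) _.
    by rewrite cLnormZ// Nf0 mule0 adde0.
  have bk := cLnorm_fcheck_sym_nonzero Mc lk nk sk.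
  have bh := cLnorm_fcheck_sym_nonzero Mc lh nh sh.
  rewrite /K EFinD EFinM fineK ?L1L2_fin_num//.
  rewrite (_ : n%:R%:E = (Normc.normc (n%:R : R[i]))%:E); last first.
    by rewrite -[X in Normc.normc X]/(1 *+ n)%R normcMn Normc.normc1.
  rewrite -cLnormZ//.
  rewrite (_ : (fun _ => _) = (fun x => fcheck sigma k x +
      -1 * fcheck sigma h x)%R); last first.
    apply/funext => x; rewrite /k fcheckD ?fcheckZ//; last exact: cLpZ.
    by ring.
  apply: le_trans (cLnormD _ q1 _ _) _.
  - exact: cmeasurable_fcheck.
  - exact: cmeasurableZ.
  - rewrite leeD//; first by rewrite (le_trans bk)// lee_wpmul2l.
    rewrite cLnormZ// (_ : Normc.normc _ = 1%R) ?mul1e//.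
    by rewrite normcN Normc.normc1.
have := cLnorm_ge0 leb q%:E (fcheck sigma f).
(* The case n = 1 excludes an infinite norm; a finite positive norm r is then refuted by taking n
   above K / r. *)
have := bound 1%N; rewrite mul1e.
case: ('Nq (fcheck sigma f)) bound => [r| |]// bound _ _.
rewrite lee_fin leNgt; apply/negP => r0.
have K0 : (0 <= K / r)%R.
  rewrite divr_ge0 ?(ltW r0)// /K addr_ge0// mulr_ge0// fine_ge0//;
    exact: cLnorm_ge0.
have := bound (Num.bound (K / r)).
by rewrite -EFinM lee_fin -ler_pdivlMr// leNgt archi_boundP.
Qed.

(** Neither f nor its parts need be nonzero for [sigma'], since [cLnorm_fcheck_sym] bounds null
    symmetric functions as well. The competitor [h] serves to produce a symmetric one and to give c
    >= 0. *)
Lemma cLnorm_fcheck_le (c : R) h f : Ms <= c%:E ->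
  L1L2 sigma sigma' h -> nonzero sigma' h -> L1L2 sigma sigma' f ->
  'Nq (fcheck sigma f) <= c%:E * 'N2 f.
Proof.
move=> Mc lh nh lf; have [k [lk nk sk]] := exists_sym_nonzero lh nh.
have [lf1 /cLp_cmeasurable mf] := lf; have mfF := cmeasurable_fcheck lf1.
have c0 : (0 <= c)%R.
  rewrite -lee_fin (le_trans (ratio_ge0 k (fcheck sigma k)))//.
  by apply: le_trans Mc; apply: ereal_sup_ubound; exists k.
apply: lee_sqrE; first by rewrite mule_ge0 ?lee_fin ?cLnorm_ge0.
have lNf := L1L2Z (- 'i%C)%R lf.
have bg := cLnorm_fcheck_sym Mc lk nk sk (L1L2_symr lf) (conj_sym_symr f).
have bh := cLnorm_fcheck_sym Mc lk nk sk (L1L2_symr lNf) (conj_sym_symr (Ni f)).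
have sqrM (x y : \bar R) : (x * y) ^+ 2 = x ^+ 2 * y ^+ 2.
  by rewrite !expe2 muleACA.
apply: le_trans (cLnorm_sqr_le _ hq mfF) _.
rewrite sqrM (cLnorm2_symr S_sym sigma'_on_S sigma'_sym mf).
rewrite ge0_muleDr ?sqre_ge0//.
rewrite -!sqrM; apply: leeD.
- rewrite lee_sqr ?mule_ge0 ?lee_fin ?cLnorm_ge0//.
  by move: bg; rewrite fcheck_symr.
- rewrite lee_sqr ?mule_ge0 ?lee_fin ?cLnorm_ge0//.
  move: bh; rewrite fcheck_symr; last exact: lNf.1.
  by rewrite fcheckZ//; under [in X in X -> _]eq_fun do rewrite -Complex_Im.
Qed.

Lemma calM_eq : M = Ms.
Proof.
apply/eqP; rewrite eq_le; apply/andP; split; last first.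
  by apply: le_ereal_sup => _ [f [lf nf sf] <-]; exists f.
apply: ub_ereal_sup => _ [f [lf nf] <-].
have [k [lk nk sk]] := exists_sym_nonzero lf nf.
(* Excludes the value -oo of an empty supremum; the value +oo is trivial, leaving a real bound. *)
have Ms0 : 0 <= Ms.
  apply: le_trans (ratio_ge0 k (fcheck sigma k)) _.
  by apply: ereal_sup_ubound; exists k.
case E : Ms Ms0 => [c| |]// _; last by rewrite leey.
rewrite ratio_le ?L1L2_fin_num//; last exact/(nonzero_cLnorm lf.2).
by apply: (cLnorm_fcheck_le _ lf nf lf); rewrite E.
Qed.

(** * Optimizers and transforms defined as limits *)

Local Notation is_check := (is_check sigma sigma' q%:E).

Lemma is_check_cmeasurable f F : is_check f F -> cmeasurable F.
Proof.
by move=> [[lf ->]|[_ /cLp_cmeasurable//]]; exact: cmeasurable_fcheck.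
Qed.

Lemma cmeasurable_Re F : cmeasurable F ->
  cmeasurable (fun x => Complex (complex.Re (F x)) 0%R).
Proof. by move=> [mr _]; split=> //; exact: measurable_cst. Qed.

(** In the limit case the approximants are symmetrized too: [symr] contracts the L^2([sigma'])
    distance, and taking real parts contracts the L^q distance. *)
Lemma is_check_symr f F : cLp sigma' 2%:E f -> is_check f F ->
  is_check (symr f) (fun x => Complex (complex.Re (F x)) 0%R).
Proof.
move=> lf [[lf1 ->]|[Moo lF [f_ [lf_ cf cF]]]].
  by left; split; [exact: cLp_symr|rewrite fcheck_symr].
have mF := cLp_cmeasurable lF; have mf := cLp_cmeasurable lf.
right; split=> //.
  have [mr mi] := cmeasurable_Re mF.
  split=> //; have [_ _] := lF; apply: le_lt_trans.
  by apply: le_cLnorm => // x; rewrite normc_complexr ler_Re_normc.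
exists (fun k => symr (f_ k)); split.
- by move=> k; exact: L1L2_symr.
- apply: (squeeze_cvge _ (cvg_cst 0) cf); apply/nearW => k.
  rewrite cLnorm_ge0/=; under [X in cLnorm _ _ X]eq_fun do rewrite symrB.
  apply: le_cLnorm_symr => //; apply: cmeasurableB => //.
  by have [_ /cLp_cmeasurable] := lf_ k.
- apply: (squeeze_cvge _ (cvg_cst 0) cF); apply/nearW => k.
  have [lk _] := lf_ k; rewrite cLnorm_ge0/= fcheck_symr//.
  have mD := cmeasurableB (cmeasurable_fcheck lk) mF.
  apply: le_cLnorm => // [|x].
    by apply: cmeasurableB; apply: cmeasurable_Re => //; exact: cmeasurable_fcheck.
  by rewrite Complex_ReB normc_complexr ler_Re_normc.
Qed.

Lemma is_check_Ni f F : cLp sigma' 2%:E f -> is_check f F ->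
  is_check (Ni f) (Ni F).
Proof.
move=> lf [[lf1 ->]|[Moo lF [f_ [lf_ cf cF]]]].
  by left; split; [exact: cLpZ|rewrite fcheckZ].
have nNiB (z y : R[i]) :
    Normc.normc (- 'i%C * z - - 'i%C * y)%R = Normc.normc (z - y)%R.
  by rewrite -mulrBr Normc.normcM normcNi mul1r.
right; split=> //; first exact: cLpZ.
exists (fun k => Ni (f_ k)); split.
- by move=> k; exact: L1L2Z.
- rewrite (_ : (fun k : nat => _) =
      (fun k => cLnorm sigma' 2%:E (fun w => f_ k w - f w)%R))//.
  by apply/funext => k; apply: eq_cLnorm => w; exact: nNiB.
- rewrite (_ : (fun k : nat => _) =
      (fun k => cLnorm leb q%:E (fun x => fcheck sigma (f_ k) x - F x)%R))//.
  apply/funext => k; apply: eq_cLnorm => x; rewrite fcheckZ ?nNiB//.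
  by have [] := lf_ k.
Qed.

Lemma is_check_le (c : R) h f F : M <= c%:E ->
  L1L2 sigma sigma' h -> nonzero sigma' h -> cLp sigma' 2%:E f ->
  is_check f F -> 'Nq F <= c%:E * 'N2 f.
Proof.
rewrite calM_eq => Mc lh nh lf fF.
have mF := is_check_cmeasurable fF; have mf := cLp_cmeasurable lf.
case: fF => [[lf1 ->]|[Moo lF [f_ [lf_ cf cF]]]].
  exact: cLnorm_fcheck_le Mc lh nh _.
have ffin : 'N2 f \is a fin_num by have [_ _ ?] := lf; rewrite ge0_fin_numE ?cLnorm_ge0.
(* By the triangle inequality on both sides, every term of this sequence is at least the norm of
   [F], while its limit is c ||f||. *)
have lim : c%:E * ('N2 f + cLnorm sigma' 2%:E (fun w => (f_ k w - f w)%R)) +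
    cLnorm leb q%:E (fun x => (fcheck sigma (f_ k) x - F x)%R)
    @[k --> \oo] --> c%:E * ('N2 f + 0) + 0.
  apply: cvgeD => //; first by rewrite adde0 -(fineK ffin).
  apply: cvgeZl => //; apply: cvgeD => //; first by rewrite fin_num_adde_defl.
  exact: cvg_cst.
rewrite !adde0 in lim; apply: (cvge_to_ge lim); apply/nearW => k.
have [lk1 lk2] := lf_ k; have mk := cLp_cmeasurable lk2.
have mkF := cmeasurable_fcheck lk1.
have c0 : (0 <= c)%R.
  rewrite -lee_fin; apply: le_trans Mc; rewrite -calM_eq.
  apply: le_trans (ratio_ge0 h (fcheck sigma h)) _.
  by apply: ereal_sup_ubound; exists h.
have FE : 'Nq F <= 'Nq (fcheck sigma (f_ k)) +
    cLnorm leb q%:E (fun x => (fcheck sigma (f_ k) x - F x)%R).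
  rewrite [leLHS](_ : _ = cLnorm leb q%:E (fun x => fcheck sigma (f_ k) x +
    -1 * (fcheck sigma (f_ k) x - F x))%R); last first.
    by apply: eq_cLnorm => x; congr Normc.normc; ring.
  apply: le_trans (cLnormD _ q1 mkF _) _.
    by apply: cmeasurableZ; exact: cmeasurableB.
  rewrite leeD2l// cLnormZ//; last exact: cmeasurableB.
  by rewrite normcN Normc.normc1 mul1e.
apply: le_trans FE _; rewrite leeD2r//.
apply: le_trans (cLnorm_fcheck_le Mc lh nh (lf_ k)) _.
rewrite lee_wpmul2l// [leLHS](_ : _ = cLnorm sigma' 2%:E (fun w =>
    f w + (f_ k w - f w))%R); first exact: cLnormD p1 mf (cmeasurableB mk mf).
by apply: eq_cLnorm => w; congr Normc.normc; ring.
Qed.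

Lemma attains_ratio (c : R) f F : cLp sigma' 2%:E f -> 0 < 'N2 f ->
  ('Nq F / 'N2 f = c%:E) <-> ('Nq F = c%:E * 'N2 f).
Proof.
move=> [_ _ ffin] f0; case: ('N2 f) ffin f0 => [r| |]// _; rewrite lte_fin => r0.
rewrite inver gt_eqF//; split=> [<-|->].
  by rewrite -muleA -EFinM mulVf ?mule1// gt_eqF.
by rewrite -muleA -!EFinM divff ?mulr1 ?gt_eqF.
Qed.

Lemma exists_nonzero : M != -oo ->
  exists f, L1L2 sigma sigma' f /\ nonzero sigma' f.
Proof.
move=> /eqP Moo; apply: contrapT => /forallNP nof; apply: Moo.
rewrite /calM (_ : [set _ | _ in _] = set0) ?ereal_sup0//.
by apply/seteqP; split=> // y [f ff _]; exact: nof f ff.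
Qed.

(* The bound ||F||^2 <= ||Re F||^2 + ||Im F||^2 <= c^2 (||g||^2 + ||h||^2)
   = c^2 ||f||^2 is an equality, hence so are the bounds for g and h. *)
Lemma optimizer_parts (c : R) f F : M = c%:E -> cLp sigma' 2%:E f ->
  nonzero sigma' f -> is_check f F -> 'Nq F / 'N2 f = c%:E ->
  optimizer_sym sigma sigma' q%:E (symr f) \/
  optimizer_sym sigma sigma' q%:E (symr (Ni f)).
Proof.
move=> Mc lf nf fF rF.
(* f itself may fail to be in L^1([sigma]); the competitor needed for [is_check_le] comes from the
   supremum not being -oo. *)
have [k [lk nk]] : exists f, L1L2 sigma sigma' f /\ nonzero sigma' f.
  by apply: exists_nonzero; rewrite Mc.
have mf := cLp_cmeasurable lf; have mF := is_check_cmeasurable fF.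
have lNf : cLp sigma' 2%:E (Ni f) by exact: cLpZ.
have f0 : 0 < 'N2 f by exact/nonzero_cLnorm.
have cG := is_check_symr lf fF.
have cH := is_check_symr lNf (is_check_Ni lf fF).
have lg := cLp_symr S_sym sigma'_on_S sigma'_sym p1 lf.
have lh := cLp_symr S_sym sigma'_on_S sigma'_sym p1 lNf.
have Mc' : M <= c%:E by rewrite Mc.
have bG := is_check_le Mc' lk nk lg cG.
have bH := is_check_le Mc' lk nk lh cH.
have nF := (attains_ratio c F lf f0).1 rF.
have FGH := cLnorm_sqr_le leb hq mF.
have fgh := cLnorm2_symr S_sym sigma'_on_S sigma'_sym mf.
have HE : cLnorm leb q%:E (fun x => Complex (complex.Im (F x)) 0%R) =
    cLnorm leb q%:E (fun x => Complex (complex.Re (- 'i%C * F x)%R) 0%R).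
  by apply: eq_cLnorm => x; rewrite Complex_Im.
rewrite HE nF {HE} in FGH.
pose G (x : borelRV R N) := Complex (complex.Re (F x)) 0%R.
pose H (x : borelRV R N) := Complex (complex.Re (- 'i%C * F x)%R) 0%R.
rewrite -/G in cG bG FGH; rewrite -/H in cH bH FGH.
set g := symr f in lg cG bG fgh *; set h := symr (Ni f) in lh cH bH fgh *.
have gh_eq : 'Nq G = c%:E * 'N2 g /\ 'Nq H = c%:E * 'N2 h.
  have [_ _ ffin] := lf; have [_ _ gfin] := lg; have [_ _ hfin] := lh.
  move: (cLnorm_ge0 leb q%:E G) (cLnorm_ge0 leb q%:E H) bG bH FGH fgh ffin gfin hfin.
  move: (cLnorm_ge0 sigma' 2%:E f) (cLnorm_ge0 sigma' 2%:E g) (cLnorm_ge0 sigma' 2%:E h).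
  case: ('N2 f) => [z| |]//; case: ('N2 g) => [x| |]//; case: ('N2 h) => [y| |]//.
  case: ('Nq G) => [a| |]//; case: ('Nq H) => [b| |]//.
  rewrite !expe2 -!EFinM -!EFinD !lee_fin => z0 x0 y0 a0 b0 acx bcy czab [zxy] _ _ _.
  have [-> ->] // : a = (c * x)%R /\ b = (c * y)%R.
  (* The bounds [bG] and [bH] have made the norms of G and H real, so the equality case applies with
     u = c ||g|| and v = c ||h||, whose squares sum to c^2 ||f||^2. *)
  apply: sqr_sum_eq => //; apply: le_trans czab.
  rewrite le_eqVlt; apply/orP; left; apply/eqP.
  by rewrite [RHS]mulrACA zxy; ring.
have attain g' G' : cLp sigma' 2%:E g' -> nonzero sigma' g' ->
    is_check g' G' -> 'Nq G' = c%:E * 'N2 g' -> conj_sym sigma sigma' g' ->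
    optimizer_sym sigma sigma' q%:E g'.
  move=> lg' ng' cG' eG' sg'; split=> //; exists G' => //.
  rewrite -calM_eq Mc; apply/attains_ratio => //.
  exact/nonzero_cLnorm.
(* Both parts satisfy the equality, but a [sigma']-null part is no optimizer; at least one part is
   not null. *)
have [ng|nh] := nonzero_symr nf.
  by left; exact: (attain _ _ lg ng cG gh_eq.1 (conj_sym_symr _)).
by right; exact: (attain _ _ lh nh cH gh_eq.2 (conj_sym_symr _)).
Qed.

(** With an infinite supremum, a symmetric competitor is an optimizer as soon as its transform has
    infinite norm. If g is [sigma']-null, then h qualifies when its transform has infinite norm, and
    otherwise h + g does: it is as nonzero as h, and subtracting a transform of finite norm cannot
    make that of g infinite unless the sum's already is. *)
Lemma optimizer_sym_pinfty g h : M = +oo ->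
  L1L2 sigma sigma' g -> conj_sym sigma sigma' g ->
  L1L2 sigma sigma' h -> conj_sym sigma sigma' h ->
  nonzero sigma' g \/ nonzero sigma' h -> 'Nq (fcheck sigma g) = +oo ->
  exists k, optimizer_sym sigma sigma' q%:E k.
Proof.
move=> Moo lg sg lh sh gh goo.
suff [k [lk nk sk koo]] : exists k, [/\ L1L2 sigma sigma' k, nonzero sigma' k,
    conj_sym sigma sigma' k & 'Nq (fcheck sigma k) = +oo].
  exists k; split=> //; first exact: lk.2.
  exists (fcheck sigma k); first by left; split=> //; exact: lk.1.
  rewrite koo -calM_eq Moo; have := (nonzero_cLnorm lk.2).1 nk.
  have := L1L2_fin_num lk; case: ('N2 k) => [r| |]// _; rewrite lte_fin => r0.
  by rewrite inver gt_eqF// gt0_mulye// lte_fin invr_gt0.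
have [ng|/contrapT g0] := pselect (nonzero sigma' g); first by exists g.
case: gh => // nh.
have [hoo|hoo] := eqVneq ('Nq (fcheck sigma h)) +oo; first by exists h.
have mhF := cmeasurable_fcheck lh.1; have mgF := cmeasurable_fcheck lg.1.
exists (fun w => (h w + g w)%R); split.
- exact: L1L2D.
- move=> k0; apply: nh; apply: filterS2 k0 g0 => w + gw.
  by rewrite gw addr0.
- exact: conj_symD.
- rewrite fcheckD; [|exact: lh.1|exact: lg.1].
  have : 'Nq (fcheck sigma g) <= cLnorm leb q%:E (fun x => fcheck sigma h x +
      fcheck sigma g x)%R + 'Nq (fcheck sigma h).
    rewrite [leLHS](_ : _ = cLnorm leb q%:E (fun x => (fcheck sigma h x +
      fcheck sigma g x) + -1 * fcheck sigma h x)%R); last first.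
      by apply: eq_cLnorm => x; congr Normc.normc; ring.
    apply: le_trans (cLnormD _ q1 _ _) _.
    - exact: cmeasurableD.
    - exact: cmeasurableZ.
    - by rewrite leeD2l// cLnormZ// normcN Normc.normc1 mul1e.
  rewrite goo leye_eq => /eqP; case: (cLnorm _ _ _) => [r| |]//.
  case: ('Nq (fcheck sigma h)) hoo => //.
Qed.

Lemma exists_optimizer_sym f : optimizer sigma sigma' q%:E f ->
  exists g, optimizer_sym sigma sigma' q%:E g.
Proof.
move=> [lf nf [F fF rF]].
have : 0 <= M by rewrite -rF ratio_ge0.
case E : M rF => [c| |]// rF _.
  by have [og|oh] := optimizer_parts E lf nf fF rF; [exists (symr f)|exists (symr (Ni f))].
(* Transforms defined as limits presuppose a finite supremum, so here f is in L^1([sigma]) and [F]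
   is given by the integral. *)
case: fF => [[lf1 FE]|[]]; last by rewrite E.
have lf12 : L1L2 sigma sigma' f by split.
have lNf := L1L2Z (- 'i%C)%R lf12.
have Foo : 'Nq F = +oo.
  move: rF; have := (nonzero_cLnorm lf).1 nf.
  have := L1L2_fin_num lf12; case: ('N2 f) => [r| |]// _; rewrite lte_fin => r0.
  by rewrite inver gt_eqF//; case: ('Nq F) (cLnorm_ge0 leb q%:E F).
have mF : cmeasurable F by rewrite FE; exact: cmeasurable_fcheck.
(* The infinite norm of [F] forces its real or its imaginary part to have infinite norm; these are
   the transforms of the two symmetric parts. *)
have := cLnorm_sqr_le leb hq mF; rewrite Foo {1}expe2 mulyy leye_eq => /eqP.
have -> : cLnorm leb q%:E (fun x => Complex (complex.Re (F x)) 0%R) =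
    'Nq (fcheck sigma (symr f)) by rewrite FE fcheck_symr.
have -> : cLnorm leb q%:E (fun x => Complex (complex.Im (F x)) 0%R) =
    'Nq (fcheck sigma (symr (Ni f))).
  rewrite FE fcheck_symr ?fcheckZ//; last exact: lNf.1.
  by apply: eq_cLnorm => x; rewrite Complex_Im.
have gh := nonzero_symr nf.
have hg : nonzero sigma' (symr (Ni f)) \/ nonzero sigma' (symr f).
  by case: gh; [right|left].
have [goo _|goo] := eqVneq ('Nq (fcheck sigma (symr f))) +oo.
  apply: (optimizer_sym_pinfty E _ _ _ _ gh goo); do ?exact: conj_sym_symr;
    exact: L1L2_symr.
have [hoo _|hoo] := eqVneq ('Nq (fcheck sigma (symr (Ni f)))) +oo.
  apply: (optimizer_sym_pinfty E _ _ _ _ hg hoo); do ?exact: conj_sym_symr; exact: L1L2_symr.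
move: goo hoo (cLnorm_ge0 leb q%:E (fcheck sigma (symr f)))
  (cLnorm_ge0 leb q%:E (fcheck sigma (symr (Ni f)))).
by case: ('Nq (fcheck sigma (symr f))) => [a| |]//; case: ('Nq _).
Qed.

End extremizers.

Theorem lemmaF1 (R : realType) (N : nat) (hN : (1 <= N)%N)
  (S : set 'rV[R]_N)
  (sigma sigma' : {measure set (onset S) -> \bar R})
  (sigma_on_S : sigma (~` S) = 0%E)
  (sigma'_on_S : sigma' (~` S) = 0%E)
  (S_sym : S = [set - x | x in S])
  (sigma_sym : forall A : set 'rV[R]_N,
     measurable (A : set (onset S)) -> A `<=` S ->
     sigma A = sigma [set - x | x in A])
  (sigma'_sym : forall A : set 'rV[R]_N,
     measurable (A : set (onset S)) -> A `<=` S ->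
     sigma' A = sigma' [set - x | x in A])
  (q : R) (hq : 2 <= q) :
  calM sigma sigma' q%:E = calM_sym sigma sigma' q%:E /\
  ((exists f : onset S -> R[i], optimizer sigma sigma' q%:E f) <->
   (exists f : onset S -> R[i], optimizer_sym sigma sigma' q%:E f)).

Proof.
have ME := calM_eq sigma_on_S sigma'_on_S S_sym sigma_sym sigma'_sym hq.
split=> //; split=> [[f of_]|[f [lf nf _ af]]].
  exact: (exists_optimizer_sym sigma_on_S sigma'_on_S S_sym sigma_sym
    sigma'_sym hq of_).
(* [is_check] refers to [calM] for both kinds of optimizer, so once the two suprema agree a
   symmetric optimizer attains [calM] with the same transform. *)
by exists f; split=> //; rewrite ME.
Qed.
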